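(* Let $m \ge 3$ and $k$ be integers with $k \ge (m+1)/2$. Then for every $\epsilon > 0$ there is an $m$-dimensional tube with $k$-thickness 1 embedded in the ball $B^m(\epsilon) \subset \mathbb{R}^m$; that is, there exist $\delta > 0$ and a $k$-expanding embedding $I: S^1(\delta) \times B^{m-1}(1) \to \mathbb{R}^m$ whose image lies in $B^m(\epsilon)$.
   Context: $S^1(\delta)$ is the circle of radius $\delta$, and $B^{d}(R)$ is the Euclidean $d$-ball of radius $R$; $S^1(\delta)\times B^{m-1}(R)$ carries the product metric. An embedding is $k$-expanding if it increases or preserves the $k$-dimensional volume of every $k$-dimensional surface in the domain (equivalently, its inverse, defined on the image, has $k$-dilation $\le 1$). A tube with $k$-thickness $R$ in $\mathbb{R}^m$ is a $k$-expanding embedding of $S^1(\delta) \times B^{m-1}(R)$ into $\mathbb{R}^m$ for some $\delta > 0$. *)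

(* Defs.v *)
From HB Require Import structures.
From mathcomp Require Import all_boot all_order all_algebra.
From mathcomp Require Import all_classical all_reals all_analysis.

Set Implicit Arguments.
Unset Strict Implicit.
Unset Printing Implicit Defensive.

Import Order.TTheory GRing.Theory Num.Theory.
Import numFieldNormedType.Exports.

Local Open Scope classical_set_scope.
Local Open Scope ring_scope.

(* R^n is 'rV[R]_n.  The library norm on it is the sup norm: it induces the
   usual topology and the usual derivatives, but Euclidean lengths need enorm. *)
Definition enorm (R : realType) (n : nat) (x : 'rV[R]_n) : R :=
  Num.sqrt (\sum_(i < n) x ord0 i ^+ 2).

Definition eball (R : realType) (n : nat) (r : R) : set 'rV[R]_n :=
  [set x | enorm x <= r].

(* S^1(delta) x B^{m-1}(r), as a subset of R^2 x R^{m-1} = R^{2 + (m-1)}; the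
   Euclidean metric of the ambient space induces the product metric on it. *)
Definition solid_tube (R : realType) (m : nat) (delta r : R) :
    set 'rV[R]_(2 + m.-1) :=
  [set x | enorm (lsubmx x) = delta /\ eball r (rsubmx x)].

(* Tangent space of the tube at x (also at boundary points): the circle
   component of v is orthogonal to the radius, the other one is arbitrary. *)
Definition tube_tangent (R : realType) (m : nat) (x : 'rV[R]_(2 + m.-1)) :
    set 'rV[R]_(2 + m.-1) :=
  [set v | lsubmx v *m (lsubmx x)^T = 0].

(* f is C^r on the open set U. *)
Fixpoint is_Cr (R : realType) (a b : nat) (U : set 'rV[R]_a) (r : nat)
    (f : 'rV[R]_a -> 'rV[R]_b) : Prop :=
  match r with
  | 0 => forall x, U x -> {for x, continuous f}
  | s.+1 => (forall x, U x -> differentiable f x) /\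
            (forall v, is_Cr U s (fun x => 'D_v f x))
  end.

(* I is a total function, but only its values on the tube matter: smoothness
   on the (closed) tube means having a smooth extension to a neighbourhood, and
   tube_tangent only involves derivatives that are determined by I on the tube.
   The last clause says that I is a homeomorphism onto its image. *)
Definition smooth_tube_embedding (R : realType) (m : nat) (delta r : R)
    (I : 'rV[R]_(2 + m.-1) -> 'rV[R]_m) : Prop :=
  [/\ exists U : set 'rV[R]_(2 + m.-1),
        [/\ open U, solid_tube delta r `<=` U & forall s, is_Cr U s I],
      forall x v, solid_tube delta r x -> tube_tangent x v ->
        'D_v I x = 0 -> v = 0
    & exists J : 'rV[R]_m -> 'rV[R]_(2 + m.-1),
        (forall x, solid_tube delta r x -> J (I x) = x) /\
        {within I @` solid_tube delta r, continuous J} ].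

(* Integral over R^n of a nonnegative measurable function with respect to
   n-dimensional Lebesgue measure, as an iterated integral (Tonelli). *)
Fixpoint integral_Rn (R : realType) (n : nat) :
    ('rV[R]_n -> \bar R) -> \bar R :=
  match n return ('rV[R]_n -> \bar R) -> \bar R with
  | 0 => fun f => f 0
  | p.+1 => fun f =>
      (\int[@lebesgue_measure R]_x
         integral_Rn (fun y : 'rV[R]_p => f (row_mx x%:M y : 'rV[R]_(1 + p))))%E
  end.

(* A k-dimensional C^1 surface phi : U -> R^n lying in A.  U is any open set,
   connected or not; hence every k-dimensional submanifold is, up to a set of
   k-dimensional measure zero, the image of a single such phi. *)
Definition k_surface (R : realType) (k n : nat) (A : set 'rV[R]_n)
    (U : set 'rV[R]_k) (phi : 'rV[R]_k -> 'rV[R]_n) : Prop :=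
  [/\ open U, is_Cr U 1 phi,
      forall x y, U x -> U y -> phi x = phi y -> x = y,
      forall x, U x -> row_free ('J phi x)
    & phi @` U `<=` A].

(* k-dimensional volume of the surface phi(U): the integral over U of the
   square root of the Gram determinant of the partial derivatives of phi (the
   rows of 'J phi x). *)
Definition k_volume (R : realType) (k n : nat) (U : set 'rV[R]_k)
    (phi : 'rV[R]_k -> 'rV[R]_n) : \bar R :=
  integral_Rn
    ((fun x => (Num.sqrt (\det ('J phi x *m ('J phi x)^T)))%:E) \_ U).

Definition k_expanding (R : realType) (k n m : nat) (A : set 'rV[R]_n)
    (I : 'rV[R]_n -> 'rV[R]_m) : Prop :=
  forall (U : set 'rV[R]_k) (phi : 'rV[R]_k -> 'rV[R]_n),
    k_surface A U phi -> (k_volume U phi <= k_volume U (I \o phi))%E.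

(* I is an m-dimensional tube with k-thickness r, with circle of radius delta. *)
Definition thick_tube (R : realType) (m k : nat) (r delta : R)
    (I : 'rV[R]_(2 + m.-1) -> 'rV[R]_m) : Prop :=
  [/\ 0 < delta, smooth_tube_embedding delta r I
    & k_expanding k (solid_tube delta r) I].

(* Main.v *)
Require Import Defs.
From mathcomp Require Import all_boot all_order all_algebra.
From mathcomp Require Import all_classical all_reals all_analysis.
From mathcomp Require Import ring lra.
Import Order.TTheory GRing.Theory Num.Theory.
Import numFieldNormedType.Exports.
Local Open Scope classical_set_scope.
Local Open Scope ring_scope.

(* Let w = L^-(k-1) with L large.  The circle and one coordinate of the ball
   are sent, by polar coordinates, to an annulus of width w in R^2, and the
   other m - 2 coordinates are stretched by L.  When delta = w / L the circle is
   stretched by at least L as well, so only one singular value, w, is below L,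
   and the k smallest ones have product at least w L^(k-1) = 1.  The image lies
   in a box with sides of order w, w, L, ..., L, whose product L^(m-2k) is small
   because m < 2k.  Folding up this box does not need any cut-off: the log spiral
   z |-> r exp(alpha z) in two of the coordinates is conformal with factor at
   least 1, injective on a strip A x w for suitable alpha, and has image of
   radius O(sqrt(A w)).  It thus replaces two side lengths by their geometric
   mean, up to a constant.  Finitely many such steps, in a number depending only
   on m and k, make all the exponents of L negative. *)

Set Implicit Arguments.
Unset Strict Implicit.
Unset Printing Implicit Defensive.

(** * Determinants of Gram matrices *)

Definition psd (R : realDomainType) k (S : 'M[R]_k) :=
  forall x : 'rV_k, 0 <= (x *m S *m x^T) 0 0.

(** If the determinant were negative, t |-> det (t + S) would be negative at 0 and positive beyond
    the Cauchy bound, hence would have a root t > 0. An eigenvector v of -S for t then gives v S v^T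
    = - t |v|^2 < 0. *)
Lemma det_psd_ge0 (R : rcfType) k (S : 'M[R]_k) :
  psd S -> 0 <= \det S.
Proof.
move=> S0; rewrite leNgt; apply/negP => detS.
pose p := char_poly (- S).
have p0 : p.[0] = \det S.
  rewrite horner_coef0 char_poly_det -[X in \det X]scaleN1r detZ mulrA -expr2.
  by rewrite sqrr_sign mul1r.
have [b pb] := monic_Cauchy_bound (char_poly_monic (- S)).
have hb : p.[0] <= 0 <= p.[Num.max 0 b].
  rewrite p0 (ltW detS) ltW// pb// le_max lexx orbT //.
have m0 : 0 <= Num.max 0 b by rewrite le_max lexx.
have [t /andP[t0 _] rt] := poly_ivt m0 hb.
have tn0 : t != 0.
  by apply: contraTneq rt => ->; rewrite rootE p0 lt_eqF.
have /eigenvalueP [v vS vn0] : eigenvalue (- S) t by rewrite eigenvalue_root_char.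
have := S0 v.
have -> : v *m S = - (t *: v) by rewrite -vS mulmxN opprK.
rewrite mulNmx -scalemxAl !mxE oppr_ge0 leNgt => /negP; apply.
have [i vi] : exists i, v 0 i != 0 by apply/rV0Pn.
rewrite mulr_gt0// ?[0 < t]lt_neqAle 1?eq_sym ?tn0// (bigD1 i)//=.
rewrite ltr_pwDl//; first by rewrite mxE -expr2 exprn_even_gt0.
by rewrite sumr_ge0// => j _; rewrite mxE -expr2 sqr_ge0.
Qed.

(** By a Schur complement, the determinant of S + u b c equals that of a bordered matrix in which u
    occurs only in the first row, affinely; multilinearity in that row concludes. *)
Lemma det_rank1_update (R : comNzRingType) k (S : 'M[R]_k) (b : 'cV[R]_k)
    (c : 'rV[R]_k) (u : R) :
  \det (S + u *: (b *m c)) = u * \det (S + b *m c) + (1 - u) * \det S.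
Proof.
pose D u := block_mx 1%:M (- (u *: c)) b S : 'M[R]_(1 + k).
have detD v : \det (S + v *: (b *m c)) = \det (D v).
  have -> : D v = block_mx 1%:M 0 b 1%:M *m
                  block_mx 1%:M (- (v *: c)) 0 (S + v *: (b *m c)).
    rewrite mulmx_block !mul1mx !mul0mx mulmx1 !addr0 mulmxN -scalemxAr.
    by rewrite addrCA addNr addr0.
  by rewrite det_mulmx det_lblock det_ublock !det1 !mul1r.
have -> : \det (S + b *m c) = \det (D 1) by rewrite -detD scale1r.
have -> : \det S = \det (D 0) by rewrite -detD scale0r addr0.
rewrite detD; apply: (@determinant_multilinear _ _ _ _ _ (lshift k 0)).
- apply/rowP => j; rewrite !mxE.
  rewrite !(unsplitK (inl 0)) !mxE.
by case: fintype.split => l; rewrite !mxE; ring.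
- apply/matrixP => i j; rewrite !mxE /=.
  case: splitP => l /= il; rewrite !mxE//.
  by move: il; rewrite ord1 /= /bump.
- apply/matrixP => i j; rewrite !mxE /=.
  case: splitP => l /= il; rewrite !mxE//.
  by move: il; rewrite ord1 /= /bump.
Qed.

Lemma psdD (R : realDomainType) k (S T : 'M[R]_k) : psd S -> psd T -> psd (S + T).
Proof. by move=> S0 T0 x; rewrite mulmxDr mulmxDl mxE addr_ge0. Qed.

Lemma psdZ (R : realDomainType) k (S : 'M[R]_k) (u : R) :
  0 <= u -> psd S -> psd (u *: S).
Proof. by move=> u0 S0 x; rewrite -scalemxAr -scalemxAl mxE mulr_ge0. Qed.

Lemma psd_gram (R : realDomainType) k n (P : 'M[R]_(k, n)) :
  psd (P *m P^T).
Proof.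
move=> x; rewrite mulmxA -(mulmxA (x *m P)) -trmx_mul mxE sumr_ge0// => i _.
by rewrite [_^T _ _]mxE -expr2 sqr_ge0.
Qed.

(* The determinant is affine in the weight of a rank one term, and nonnegative
   for all nonnegative weights, so it is nondecreasing. *)
Lemma det_psd_rank1_ge (R : rcfType) k (S : 'M[R]_k) (b : 'cV[R]_k) (u : R) :
  psd S -> 0 <= u ->
  \det S <= \det (S + u *: (b *m b^T)).
Proof.
move=> S0 u0.
pose d := \det (S + b *m b^T) - \det S.
have E v : \det (S + v *: (b *m b^T)) = \det S + v * d.
  by rewrite det_rank1_update /d; ring.
have psd v : 0 <= v -> 0 <= \det S + v * d.
  move=> v0; rewrite -E; apply: det_psd_ge0.
  by apply/psdD/psdZ => //; apply: psd_gram.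
rewrite E lerDl mulr_ge0// leNgt; apply/negP => d0.
have D0 : 0 <= \det S by apply: det_psd_ge0.
(* With a negative slope d, this weight would bring the affine function to the value d < 0. *)
have /psd : 0 <= \det S / - d + 1 by rewrite addr_ge0// divr_ge0// oppr_ge0 ltW.
have -> : \det S + (\det S / - d + 1) * d = d.
  by field; rewrite lt_eqF.
by rewrite leNgt d0.
Qed.

(** Squared volumes of (k+1)-dimensional parallelepipeds when one direction has squared stretch c
    and the others a >= c: at worst one factor c occurs. After factoring out a, the rank one update
    leaves the wanted term plus a nonnegative multiple of det S. *)
Lemma det_psd_rank1_scale (R : rcfType) k (S : 'M[R]_k.+1) (b : 'cV[R]_k.+1)
    (a c : R) : psd S -> 0 < c -> c <= a ->
  a ^+ k * c * \det (S + b *m b^T) <= \det (a *: S + c *: (b *m b^T)).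
Proof.
move=> S0 c0 ca; have a0 := lt_le_trans c0 ca.
have -> : a *: S + c *: (b *m b^T) = a *: (S + (c / a) *: (b *m b^T)).
  by rewrite scalerDr scalerA mulrC divfK// gt_eqF.
rewrite detZ det_rank1_update exprS mulrDr.
have -> : a * a ^+ k * (c / a * \det (S + b *m b^T)) =
          a ^+ k * c * \det (S + b *m b^T) by field; rewrite gt_eqF.
rewrite lerDl !mulr_ge0 ?exprn_ge0 ?(ltW a0) ?det_psd_ge0//.
by rewrite subr_ge0 ler_pdivrMr ?mul1r.
Qed.

(* For B the Jacobian of a map (acting on row vectors from the right): the map
   does not decrease the volume of any parallelepiped, of any dimension. *)
Definition volume_nondecreasing (R : rcfType) n m (B : 'M[R]_(n, m)) :=
  forall k (P : 'M[R]_(k, n)),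
    \det (P *m P^T) <= \det ((P *m B) *m (P *m B)^T).

Lemma volume_nondecreasing1 (R : rcfType) n :
  volume_nondecreasing (1%:M : 'M[R]_n).
Proof. by move=> k P; rewrite mulmx1. Qed.

Lemma volume_nondecreasingM (R : rcfType) n m p (A : 'M[R]_(n, m))
    (B : 'M[R]_(m, p)) :
  volume_nondecreasing A -> volume_nondecreasing B ->
  volume_nondecreasing (A *m B).
Proof. by move=> hA hB k P; rewrite mulmxA; exact: le_trans (hA _ _) (hB _ _). Qed.

Lemma volume_nondecreasing_gram (R : rcfType) n m (B : 'M[R]_(n, m))
    (i j : 'I_n) (u : R) : 0 <= u ->
  B *m B^T = 1%:M + u *: delta_mx i i + u *: delta_mx j j ->
  volume_nondecreasing B.
Proof.
move=> u0 hB k P.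
have hcol l : P *m (u *: delta_mx l l) *m P^T = u *: (col l P *m (col l P)^T).
  by rewrite -scalemxAr -scalemxAl !colE trmx_mul trmx_delta mulmxA -(mulmxA P)
    mul_delta_mx.
rewrite trmx_mul mulmxA -(mulmxA P) hB !mulmxDr !mulmxDl mulmx1 !hcol.
apply: le_trans (det_psd_rank1_ge _ _ u0) (det_psd_rank1_ge _ _ u0).
  exact: psd_gram.
by apply/psdD/psdZ => //; apply: psd_gram.
Qed.

(** * Elementary functions *)

(** A syntactic class closed under composition and directional derivatives: all maps of the
    construction belong to it, which makes them C^r for every r on the whole space. *)
Inductive elementary (R : realType) (n : nat) : ('rV[R]_n -> R) -> Prop :=
| elementary_cst c : elementary (fun=> c)
| elementary_coord i : elementary (fun x => x 0 i)
| elementaryD f g : elementary f -> elementary g ->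
    elementary (fun x => f x + g x)
| elementaryM f g : elementary f -> elementary g ->
    elementary (fun x => f x * g x)
| elementary_expR f : elementary f -> elementary (fun x => expR (f x))
| elementary_cos f : elementary f -> elementary (fun x => cos (f x))
| elementary_sin f : elementary f -> elementary (fun x => sin (f x)).

Definition elementary_map (R : realType) n m (F : 'rV[R]_n -> 'rV[R]_m) :=
  forall j, elementary (fun x => F x 0 j).

Lemma elementary_map_id (R : realType) n : elementary_map (@id 'rV[R]_n).
Proof. by move=> j; exact: elementary_coord. Qed.

Lemma elementary_comp (R : realType) n m (F : 'rV[R]_n -> 'rV[R]_m) f :
  elementary_map F -> elementary f -> elementary (f \o F).
Proof.
move=> hF; elim=> {f} [c|i|f g _ hf _ hg|f g _ hf _ hg|f _ hf|f _ hf|f _ hf].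
- exact: elementary_cst.
- exact: hF.
- exact: elementaryD hf hg.
- exact: elementaryM hf hg.
- exact: elementary_expR hf.
- exact: elementary_cos hf.
- exact: elementary_sin hf.
Qed.

Lemma elementary_map_comp (R : realType) n m p (F : 'rV[R]_n -> 'rV[R]_m)
    (G : 'rV[R]_m -> 'rV[R]_p) :
  elementary_map F -> elementary_map G -> elementary_map (G \o F).
Proof. by move=> hF hG j; exact: elementary_comp hF (hG j). Qed.

Lemma derive_coord (R : realType) n (x v : 'rV[R]_n) i :
  'D_v (fun y : 'rV[R]_n => y 0 i) x = v 0 i.
Proof.
have := @derive_mx R 'rV[R]_n 1 n id x v (@derivable_id _ _ _ _).
by rewrite derive_id => /(congr1 (fun M : 'rV_n => M 0 i)); rewrite mxE => <-.
Qed.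

Lemma diff_comp_scalar (R : realType) (V : normedModType R) (g : R -> R)
    (dg : R) (f : V -> R) x :
  is_derive (f x) 1 g dg -> differentiable f x ->
  differentiable (fun y => g (f y)) x /\
  forall v, 'D_v (fun y => g (f y)) x = dg * 'D_v f x.
Proof.
move=> hg hf.
have dgf : differentiable g (f x).
  by apply/derivable1_diffP; apply: ex_derive.
have dgof : differentiable (g \o f) x by exact: differentiable_comp.
split=> // v; rewrite -[fun y => _]/(g \o f) !deriveE// diff_comp//=.
by rewrite diff1E//= derive1E derive_val mulrC.
Qed.

Lemma elementary_diff (R : realType) n (f : 'rV[R]_n -> R) x :
  elementary f -> differentiable f x.
Proof.
elim=> {f} [c|i|f g _ hf _ hg|f g _ hf _ hg|f _ hf|f _ hf|f _ hf].
- exact: differentiable_cst.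
- exact: differentiable_coord.
- exact: differentiableD.
- exact: differentiableM.
- exact: (diff_comp_scalar (is_derive_expR _) hf).1.
- exact: (diff_comp_scalar (is_derive_cos _) hf).1.
- exact: (diff_comp_scalar (is_derive_sin _) hf).1.
Qed.

Section ElementaryDerive.
Context {R : realType} {n : nat}.
Implicit Types (f g : 'rV[R]_n -> R) (x v : 'rV[R]_n).

Lemma derive_elementaryD f g x v : elementary f -> elementary g ->
  'D_v (fun y => f y + g y) x = 'D_v f x + 'D_v g x.
Proof. by move=> hf hg; apply: deriveD; exact/diff_derivable/elementary_diff. Qed.

Lemma derive_elementaryM f g x v : elementary f -> elementary g ->
  'D_v (fun y => f y * g y) x = f x * 'D_v g x + g x * 'D_v f x.
Proof. by move=> hf hg; apply: deriveM; exact/diff_derivable/elementary_diff. Qed.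

Lemma derive_elementary_expR f x v : elementary f ->
  'D_v (fun y => expR (f y)) x = expR (f x) * 'D_v f x.
Proof.
by move=> hf; exact: (diff_comp_scalar (is_derive_expR _) (elementary_diff x hf)).2.
Qed.

Lemma derive_elementary_cos f x v : elementary f ->
  'D_v (fun y => cos (f y)) x = - sin (f x) * 'D_v f x.
Proof.
by move=> hf; exact: (diff_comp_scalar (is_derive_cos _) (elementary_diff x hf)).2.
Qed.

Lemma derive_elementary_sin f x v : elementary f ->
  'D_v (fun y => sin (f y)) x = cos (f x) * 'D_v f x.
Proof.
by move=> hf; exact: (diff_comp_scalar (is_derive_sin _) (elementary_diff x hf)).2.
Qed.

Lemma elementary_derive f v : elementary f -> elementary ('D_v f).
Proof.
elim=> {f} [c|i|f g hf df hg dg|f g hf df hg dg|f hf df|f hf df|f hf df].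
- rewrite (_ : 'D_v _ = fun=> 0); first exact: elementary_cst.
  by apply/funext => x; exact: derive_cst.
- rewrite (_ : 'D_v _ = fun=> v 0 i); first exact: elementary_cst.
  by apply/funext => x; exact: derive_coord.
- under eq_fun do rewrite derive_elementaryD//.
  exact: elementaryD.
- under eq_fun do rewrite derive_elementaryM//.
  by apply: elementaryD; exact: elementaryM.
- under eq_fun do rewrite derive_elementary_expR//.
  by apply: elementaryM => //; exact: elementary_expR.
- under eq_fun do rewrite derive_elementary_cos// mulNr -mulN1r.
  apply: elementaryM; first exact: elementary_cst.
  by apply: elementaryM => //; exact: elementary_sin.
- under eq_fun do rewrite derive_elementary_sin//.
  by apply: elementaryM => //; exact: elementary_cos.
Qed.

End ElementaryDerive.

Section ElementaryMap.
Context {R : realType} {n m : nat}.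
Implicit Types (F : 'rV[R]_n -> 'rV[R]_m) (x v : 'rV[R]_n).

Lemma elementary_map_diff F x : elementary_map F -> differentiable F x.
Proof.
move=> hF; rewrite (_ : F = \sum_j (fun y => F y 0 j *: delta_mx 0 j)).
  apply: differentiable_sum => j; apply: differentiableZl.
  exact: elementary_diff.
by apply/funext => y; rewrite fct_sumE; exact: row_sum_delta.
Qed.

Lemma derive_elementary_map F x v j : elementary_map F ->
  ('D_v F x) 0 j = 'D_v (fun y => F y 0 j) x.
Proof.
by move=> hF; rewrite derive_mx ?mxE//; exact/diff_derivable/elementary_map_diff.
Qed.

Lemma elementary_map_derive F v : elementary_map F -> elementary_map ('D_v F).
Proof.
move=> hF j; under eq_fun do rewrite derive_elementary_map//.
exact: elementary_derive.
Qed.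

Lemma jacobian_elementary_map F x i j : elementary_map F ->
  ('J F x) i j = 'D_(delta_mx 0 i) (fun y => F y 0 j) x.
Proof.
move=> hF; rewrite -derive_elementary_map// (@deriveEjacobian _ _ _ F).
  by rewrite -rowE [in RHS]mxE.
exact: elementary_map_diff.
Qed.

Lemma elementary_map_Cr F U s : elementary_map F -> is_Cr U s F.
Proof.
elim: s F => [|s IHs] F hF /=.
  by move=> x _; exact/differentiable_continuous/elementary_map_diff.
split=> [x _|v]; first exact: elementary_map_diff.
exact/IHs/elementary_map_derive.
Qed.

End ElementaryMap.

Lemma jacobian_comp (R : realType) n m p (F : 'rV[R]_n -> 'rV[R]_m)
    (G : 'rV[R]_m -> 'rV[R]_p) x :
  differentiable F x -> differentiable G (F x) ->
  'J (G \o F) x = 'J F x *m 'J G (F x).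
Proof.
move=> dF dG; apply/row_matrixP => i; rewrite row_mul !rowE.
rewrite -!deriveEjacobian//; last exact: differentiable_comp.
rewrite deriveE; last exact: differentiable_comp.
by rewrite diff_comp//= -!deriveE.
Qed.

(** * Log spirals *)

(** After removal of full turns, a remainder w strictly between 0 and 2 pi would have sin (w / 2) >
    0, against cos w = 1 - 2 sin^2 (w / 2). *)
Lemma cos_eq1_int (R : realType) (u : R) :
  cos u = 1 -> exists n : int, u = n%:~R * (pi *+ 2).
Proof.
have pi2 : 0 < pi *+ 2 :> R by rewrite pmulrn_lgt0// pi_gt0.
suff nneg (v : R) : 0 <= v -> cos v = 1 -> exists n : nat, v = n%:R * (pi *+ 2).
  move=> cu; have [u0|u0] := leP 0 u.
    by have [n ->] := nneg u u0 cu; exists n%:Z.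
  have [|n nE] := nneg (- u) _ (etrans (cosN u) cu); first by rewrite oppr_ge0 ltW.
  by exists (- n%:Z); rewrite mulrNz mulNr -nE opprK.
move=> v0 cv; pose n := Num.truncn (v / (pi *+ 2)); exists n.
have /andP[nv vn] : n%:R <= v / (pi *+ 2) < n.+1%:R.
  by apply: truncn_itv; rewrite divr_ge0// ltW.
pose w := v - n%:R * (pi *+ 2).
have w0 : 0 <= w by rewrite subr_ge0 -ler_pdivlMr.
have w1 : w < pi *+ 2.
  by rewrite ltrBlDl; move: vn; rewrite ltr_pdivrMr// -natr1 mulrDl mul1r.
have cw : cos w = 1.
  have := periodicn (@cosD2pi R) n w.
  by rewrite -[_ *+ n]mulr_natl subrK cv.
have [w00|wn0] := eqVneq w 0; first by apply/eqP; rewrite -subr_eq0 -/w w00.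
have : sin (w / 2) > 0.
  have wp : 0 < w by rewrite lt_neqAle eq_sym wn0.
  apply: sin_gt0_pi; rewrite divr_gt0//=.
  by rewrite ltr_pdivrMr// mulr_natr.
have := cosD (w / 2) (w / 2); rewrite -splitr cw -!expr2 => h.
have := cos2Dsin2 (w / 2) => h' h''.
by have := exprn_gt0 2 h''; lra.
Qed.

Section Spiral.
Context {R : realType} {m : nat} (i j : 'I_m) (a b r : R).

(* In the complex coordinate z = x_i + sqrt(-1) x_j, this is z |-> r exp(alpha z)
   with alpha = a + b sqrt(-1): a conformal map winding a strip around a log
   spiral. *)
Definition spiral (x : 'rV[R]_m) : 'rV[R]_m :=
  \row_h if h == i then r * (expR (a * x 0 i + - b * x 0 j) *
                             cos (b * x 0 i + a * x 0 j))
         else if h == j then r * (expR (a * x 0 i + - b * x 0 j) *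
                                  sin (b * x 0 i + a * x 0 j))
         else x 0 h.

Let elementary_lin (c d : R) :
  elementary (fun x : 'rV[R]_m => c * x 0 i + d * x 0 j).
Proof.
by apply: elementaryD; apply: elementaryM;
  (exact: elementary_cst || exact: elementary_coord).
Qed.

Let derive_lin (c d : R) (x v : 'rV[R]_m) :
  'D_v (fun x : 'rV[R]_m => c * x 0 i + d * x 0 j) x = c * v 0 i + d * v 0 j.
Proof.
have ec e : elementary (fun=> e : R) by exact: elementary_cst.
have ex h : elementary (fun x : 'rV[R]_m => x 0 h) by exact: elementary_coord.
rewrite derive_elementaryD; do ?[exact: elementaryM].
by rewrite !derive_elementaryM// !derive_coord !derive_cst !mulr0 !addr0.
Qed.

Lemma spiral_elementary : elementary_map spiral.
Proof.
move=> h; under eq_fun do rewrite mxE.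
case: eqP => _; last case: eqP => _; last exact: elementary_coord.
- apply: elementaryM; first exact: elementary_cst.
  by apply: elementaryM; [exact: elementary_expR|exact: elementary_cos].
- apply: elementaryM; first exact: elementary_cst.
  by apply: elementaryM; [exact: elementary_expR|exact: elementary_sin].
Qed.

Context (ij : i != j).

(** Here u + 1 is the squared conformal factor |r alpha exp(alpha z)|^2 in the plane of the
    coordinates i and j; the other coordinates are fixed. *)
Lemma spiral_gram (x : 'rV[R]_m) :
  let u := (r * expR (a * x 0 i + - b * x 0 j)) ^+ 2 * (a ^+ 2 + b ^+ 2) - 1 in
  'J spiral x *m ('J spiral x)^T =
  1%:M + u *: delta_mx i i + u *: delta_mx j j.
Proof.
move=> u; rewrite {}/u; set E := expR _.
pose C := cos (b * x 0 i + a * x 0 j); pose S := sin (b * x 0 i + a * x 0 j).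
have CS : C ^+ 2 + S ^+ 2 = 1 by exact: cos2Dsin2.
pose e (p h : 'I_m) : R := (p == h)%:R.
have ee (p h : 'I_m) : (delta_mx 0 p : 'rV[R]_m) 0 h = e p h.
  by rewrite mxE eqxx /= eq_sym.
have Ji p : ('J spiral x) p i =
    r * E * (C * (a * e p i - b * e p j) - S * (b * e p i + a * e p j)).
  rewrite jacobian_elementary_map; last exact: spiral_elementary.
  under eq_fun do rewrite mxE eqxx.
  rewrite derive_elementaryM; [|exact: elementary_cst|by apply: elementaryM;
    [exact: elementary_expR|exact: elementary_cos]].
  rewrite derive_elementaryM; [|exact: elementary_expR|exact: elementary_cos].
  rewrite derive_elementary_expR// derive_elementary_cos// !derive_lin derive_cst.
  by rewrite !ee -/E -/C -/S; ring.
have Jj p : ('J spiral x) p j =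
    r * E * (S * (a * e p i - b * e p j) + C * (b * e p i + a * e p j)).
  rewrite jacobian_elementary_map; last exact: spiral_elementary.
  under eq_fun do rewrite mxE eq_sym (negPf ij) eqxx.
  rewrite derive_elementaryM; [|exact: elementary_cst|by apply: elementaryM;
    [exact: elementary_expR|exact: elementary_sin]].
  rewrite derive_elementaryM; [|exact: elementary_expR|exact: elementary_sin].
  rewrite derive_elementary_expR// derive_elementary_sin// !derive_lin derive_cst.
  by rewrite !ee -/E -/C -/S; ring.
have Jh p h : h != i -> h != j -> ('J spiral x) p h = e p h.
  move=> hi hj; rewrite jacobian_elementary_map; last exact: spiral_elementary.
  under eq_fun do rewrite mxE (negPf hi) (negPf hj).
  by rewrite derive_coord ee.
(* The identity matrix is written as a Gram matrix too, so that both sides are sums over h that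
   agree termwise off i and j. *)
have delta (p q : 'I_m) : e p q = \sum_h e p h * e q h.
  rewrite (bigD1 p)//= big1 ?addr0; last first.
    by move=> h hp; rewrite /e eq_sym (negPf hp) mul0r.
  by rewrite /e eqxx mul1r eq_sym.
apply/matrixP => p q; rewrite !mxE -/(e p q) delta.
rewrite (bigD1 i)//= (bigD1 j) 1?eq_sym//=.
rewrite [in RHS](bigD1 i)//= [in RHS](bigD1 j) 1?eq_sym//=.
have -> : \sum_(h < m | (h != i) && (h != j)) ('J spiral x) p h * ('J spiral x)^T h q =
          \sum_(h < m | (h != i) && (h != j)) e p h * e q h.
  by apply: eq_bigr => h /andP[hi hj]; rewrite [_^T _ _]mxE !Jh.
set T := \sum_(h < m | _) _.
rewrite ![_^T _ _]mxE !Ji !Jj.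
have dd h : ((p == h) && (q == h))%:R = e p h * e q h by rewrite /e -natrM mulnb.
rewrite !dd.
transitivity (T + (C ^+ 2 + S ^+ 2) * (r * E) ^+ 2 * (a ^+ 2 + b ^+ 2) *
  (e p i * e q i + e p j * e q j)); first by ring.
by rewrite CS; ring.
Qed.

Lemma spiral_volume_nondecreasing (x : 'rV[R]_m) :
  1 <= (r * expR (a * x 0 i + - b * x 0 j)) ^+ 2 * (a ^+ 2 + b ^+ 2) ->
  volume_nondecreasing ('J spiral x).
Proof.
by move=> h; apply: (volume_nondecreasing_gram _ (spiral_gram x)); rewrite subr_ge0.
Qed.

(* Points with the same image differ by a multiple of the period
   2 pi sqrt(-1) / alpha, whose imaginary part is 2 pi a / (a ^ 2 + b ^ 2). *)
Lemma spiral_inj (x y : 'rV[R]_m) : 0 < a -> 0 < r ->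
  `|x 0 j - y 0 j| * (a ^+ 2 + b ^+ 2) < a * (pi *+ 2) ->
  spiral x = spiral y -> x = y.
Proof.
move=> a0 r0 small xy.
have xyE h : spiral x 0 h = spiral y 0 h by rewrite xy.
set px := a * x 0 i + - b * x 0 j; set py := a * y 0 i + - b * y 0 j.
set tx := b * x 0 i + a * x 0 j; set ty := b * y 0 i + a * y 0 j.
have hc : expR px * cos tx = expR py * cos ty.
  by have := xyE i; rewrite !mxE eqxx; apply/mulfI; rewrite gt_eqF.
have hs : expR px * sin tx = expR py * sin ty.
  by have := xyE j; rewrite !mxE eq_sym (negPf ij) eqxx; apply/mulfI; rewrite gt_eqF.
have cx := cos2Dsin2 tx; have cy := cos2Dsin2 ty.
have pE : px = py.
  apply: expR_inj; apply/eqP; rewrite -(@eqrXn2 _ 2)//; try exact: expR_ge0.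
  apply/eqP; transitivity ((expR px * cos tx) ^+ 2 + (expR px * sin tx) ^+ 2).
    by rewrite !exprMn -mulrDr cx mulr1.
  by rewrite hc hs !exprMn -mulrDr cy mulr1.
move: hc hs; rewrite pE => /mulfI hc /mulfI hs.
have {}hc := hc (lt0r_neq0 (expR_gt0 _)); have {}hs := hs (lt0r_neq0 (expR_gt0 _)).
have [n nE] : exists n : int, tx - ty = n%:~R * (pi *+ 2).
  by apply: cos_eq1_int; rewrite cosB hc hs -!expr2.
(* Multiplying the difference of the two values of alpha z by the conjugate of alpha and taking
   imaginary parts isolates the coordinate j. *)
have key : (x 0 j - y 0 j) * (a ^+ 2 + b ^+ 2) = n%:~R * (a * (pi *+ 2)).
  transitivity (a * (tx - ty) - b * (px - py)); first by rewrite /tx /ty /px /py; ring.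
  by rewrite pE subrr mulr0 subr0 nE mulrCA.
have pi2 : 0 < a * (pi *+ 2) by rewrite mulr_gt0// pmulrn_lgt0// pi_gt0.
have ab0 : 0 < a ^+ 2 + b ^+ 2 by rewrite ltr_wpDr ?sqr_ge0 ?exprn_gt0.
have n0 : n = 0.
  move: small; rewrite -{1}(gtr0_norm ab0) -normrM key normrM (gtr0_norm pi2).
  rewrite gtr_pMl// -intr_norm ltrz1; apply: contraTeq => n0.
  by rewrite -leNgt -gtz0_ge1 normr_gt0.
have xj : x 0 j = y 0 j.
  apply/eqP; rewrite -subr_eq0; move: key; rewrite n0 mul0r => /eqP.
  by rewrite mulf_eq0 (gt_eqF ab0) orbF.
have xi : x 0 i = y 0 i.
  apply: (mulfI (lt0r_neq0 a0)); move: pE; rewrite /px /py xj; lra.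
apply/rowP => h; have [->//|hi] := eqVneq h i; have [->//|hj] := eqVneq h j.
by have := xyE h; rewrite !mxE (negPf hi) (negPf hj).
Qed.

End Spiral.

(** * Injective volume-nondecreasing maps between boxes *)

Definition box (R : realType) m (s : 'I_m -> R) : set 'rV[R]_m :=
  [set x | forall h, `|x 0 h| <= s h].

(** The conditions are imposed on the box only, since a spiral is injective and expanding only on a
    suitable strip; they suffice for composition because the image lies in the next box. *)
Definition squeezes (R : realType) m (s t : 'I_m -> R)
    (F : 'rV[R]_m -> 'rV[R]_m) :=
  [/\ elementary_map F,
      forall x y, box s x -> box s y -> F x = F y -> x = y,
      forall x, box s x -> box t (F x)
    & forall x, box s x -> volume_nondecreasing ('J F x)].

Section Squeezes.
Context {R : realType} {m : nat}.
Implicit Types (s t u : 'I_m -> R) (F G : 'rV[R]_m -> 'rV[R]_m).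

Lemma squeezes_id s t : (forall h, s h <= t h) -> squeezes s t id.
Proof.
move=> st; split=> //.
- exact: elementary_map_id.
- by move=> x sx h; exact: le_trans (sx h) (st h).
- move=> x _; rewrite (_ : 'J id x = 1%:M); first exact: volume_nondecreasing1.
  apply/row_matrixP => p; rewrite !rowE mulmx1 -deriveEjacobian ?derive_id//.
Qed.

Lemma squeezes_comp s t u F G :
  squeezes s t F -> squeezes t u G -> squeezes s u (G \o F).
Proof.
move=> [eF iF bF vF] [eG iG bG vG]; split.
- exact: elementary_map_comp.
- by move=> x y sx sy /iG h; apply: iF => //; apply: h; exact: bF.
- by move=> x sx; exact/bG/bF.
- move=> x sx; rewrite jacobian_comp; try exact: elementary_map_diff.
  by apply: volume_nondecreasingM; [exact: vF|exact/vG/bF].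
Qed.

(* With A = expR p and w = expR q, the rates a = 1 / (e A) and
   b = 1 / (e sqrt(A w)) keep the modulus of exp(alpha z) bounded on the strip
   and the consecutive turns of the spiral disjoint; the multiple r of
   sqrt(A w) then makes the conformal factor at least 1. *)
Lemma squeezes_spiral s (i j : 'I_m) (p q : R) : i != j -> q <= p ->
  s i = expR p -> s j = expR q ->
  exists F, squeezes s
    (fun h => if (h == i) || (h == j) then expR ((p + q) / 2 + 5) else s h) F.
Proof.
move=> ij qp si sj.
pose a : R := expR (- p - 1); pose b : R := expR (- ((p + q) / 2) - 1).
(* The log of the modulus of exp(alpha z) stays in [-2, 2] on the box. The 3 makes r b exp(-2) = 1,
   which bounds the conformal factor below, and r exp(2) is the new side length. *)
pose r : R := expR ((p + q) / 2 + 3).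
have phase x : box s x -> - 2 <= a * x 0 i + - b * x 0 j <= 2.
  move=> sx; have xi := sx i; have xj := sx j; rewrite si in xi; rewrite sj in xj.
  have : `|a * x 0 i| <= 1.
    rewrite normrM gtr0_norm ?expR_gt0//.
    apply: (@le_trans _ _ (a * expR p)); first by rewrite ler_wpM2l// expR_ge0.
    by rewrite -expRD -[leRHS]expR0 ler_expR; lra.
  have : `|b * x 0 j| <= 1.
    rewrite normrM gtr0_norm ?expR_gt0//.
    apply: (@le_trans _ _ (b * expR q)); first by rewrite ler_wpM2l// expR_ge0.
    by rewrite -expRD -[leRHS]expR0 ler_expR; lra.
  by rewrite !ler_norml => /andP[? ?] /andP[? ?]; apply/andP; split; lra.
exists (spiral i j a b r); split.
- exact: spiral_elementary.
- move=> x y sx sy; apply: spiral_inj => //; try exact: expR_gt0.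
  have xj := sx j; have yj := sy j; rewrite sj in xj yj.
  have dj : `|x 0 j - y 0 j| <= 2 * expR q.
    by rewrite (le_trans (ler_normB _ _))// mulr_natl mulr2n lerD.
  (* The term a^2 is dominated by b^2 because q <= p. The quantity to bound is then at most 4 a / e
     < 4 a <= 2 pi a. *)
  have ab : a ^+ 2 + b ^+ 2 <= 2 * expR (- (p + q) - 2).
    have h2 (z : R) : expR z ^+ 2 = expR (z + z) by rewrite expRD expr2.
    rewrite mulr_natl mulr2n lerD// h2 ler_expR; lra.
  apply: (@le_lt_trans _ _ (2 * expR q * (2 * expR (- (p + q) - 2)))).
    by apply: ler_pM => //; rewrite addr_ge0// sqr_ge0.
  have -> : 2 * expR q * (2 * expR (- (p + q) - 2)) = a * (4 * expR (- 1)).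
    rewrite mulrACA -expRD mulrCA -expRD.
    by congr (_ * expR _); [rewrite -natrM|ring].
  rewrite ltr_pM2l ?expR_gt0// (@lt_le_trans _ _ 4)//.
    by rewrite gtr_pMr// -[ltRHS]expR0 ltr_expR.
  by have := pi_ge2 R; rewrite mulr2n; lra.
- move=> x sx h.
  have bound y : `|y| <= 1 ->
      `|r * (expR (a * x 0 i + - b * x 0 j) * y)| <= expR ((p + q) / 2 + 5).
    move=> y1; have /andP[_ ph] := phase x sx.
    rewrite !normrM !(gtr0_norm (expR_gt0 _)) mulrA -expRD.
    apply: le_trans (ler_piMr (expR_ge0 _) y1) _; rewrite ler_expR; lra.
  rewrite mxE; case: eqP => _ /=; last case: eqP => _ //=.
  - by apply: bound; exact: cos_max.
  - by apply: bound; exact: sin_max.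
- move=> x sx; apply: spiral_volume_nondecreasing => //.
  have /andP[ph _] := phase x sx.
  apply: (@le_trans _ _ ((r * expR (a * x 0 i + - b * x 0 j)) ^+ 2 * b ^+ 2)).
    rewrite -exprMn exprn_ege1// -!expRD -[leLHS]expR0 ler_expR; lra.
  by rewrite ler_wpM2l ?sqr_ge0// lerDr sqr_ge0.
Qed.

End Squeezes.

(** * Folding a box by averaging exponents *)

(** Sides are powers of L = exp l up to the constant factor exp c. Negative exponents make them all
    tend to 0, so the identity works once l passes the largest threshold. *)
Lemma squeezes_negative (R : realType) m (e : 'I_m.+1 -> R) (c eps : R) :
  0 < eps -> (forall h, e h < 0) ->
  exists l0, forall l, l0 <= l ->
    exists F, squeezes (fun h => expR (l * e h + c)) (fun=> eps) F.
Proof.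
move=> eps0 e0; exists (\big[Num.max/0]_h ((ln eps - c) / e h)) => l lb.
exists id; apply: squeezes_id => h.
rewrite -[leRHS]lnK ?posrE// ler_expR -lerBrDr -ler_ndivrMr ?e0//.
by apply: le_trans lb; exact: le_bigmax.
Qed.

(* In dimension d = m + 1, averaging a nonnegative exponent with one that is at
   most -1/d keeps the sum and decreases the sum of squares by at least
   1/(2d^2). *)
Lemma squeezes_exponents (R : realType) m (e : 'I_m.+1 -> R) (c eps : R) :
  0 < eps -> \sum_h e h <= -1 ->
  exists l0, forall l, l0 <= l ->
    exists F, squeezes (fun h => expR (l * e h + c)) (fun=> eps) F.
Proof.
move=> eps0; pose M : R := m.+1%:R.
have M0 : 0 < M by rewrite ltr0n.
(* N bounds the number of remaining folds: the sum of squares is measured in units of its guaranteed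
   decrease. *)
have [N] : exists N : nat, \sum_h e h ^+ 2 < N%:R / (2 * M ^+ 2).
  exists (Num.truncn ((\sum_h e h ^+ 2) * (2 * M ^+ 2))).+1.
  rewrite ltr_pdivlMr ?mulr_gt0 ?exprn_gt0//.
  by rewrite truncnS_gt.
elim: N e c => [|N IHN] e c.
  by rewrite mul0r ltNge sumr_ge0// => h _; exact: sqr_ge0.
move=> sq sum1.
have [/forallP neg|] := boolP [forall h, e h < 0]; first exact: squeezes_negative.
rewrite negb_forall => /existsP[i]; rewrite -leNgt => ei.
have [j ej] : exists j, e j <= - M^-1.
  apply/existsP; apply/contraT; rewrite negb_exists => /forallP h.
  have : - 1 < \sum_h e h.
    have -> : - 1 = \sum_(h < m.+1) (- M^-1).
      by rewrite sumr_const card_ord -mulr_natr -/M mulNr mulVf// gt_eqF.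
    apply: ltr_sum => [|k _]; last by rewrite ltNge.
    by apply/hasP; exists ord0; rewrite ?mem_index_enum.
  by rewrite ltNge sum1.
have Mi : 0 < M^-1 by rewrite invr_gt0.
have ij : i != j by apply: contraTneq ei => ->; rewrite -ltNge (le_lt_trans ej)// oppr_lt0.
pose e' h := if (h == i) || (h == j) then (e i + e j) / 2 else e h.
have split_sum (f : 'I_m.+1 -> R) :
    \sum_h f h = f i + (f j + \sum_(h | (h != i) && (h != j)) f h).
  by rewrite (bigD1 i)//= (bigD1 j) 1?eq_sym.
have rest (f : R -> R) : \sum_(h | (h != i) && (h != j)) f (e' h) =
    \sum_(h | (h != i) && (h != j)) f (e h).
  by apply: eq_bigr => h /andP[hi hj]; rewrite /e' (negPf hi) (negPf hj).
have e'i : e' i = (e i + e j) / 2 by rewrite /e' eqxx.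
have e'j : e' j = (e i + e j) / 2 by rewrite /e' eqxx orbT.
have sum' : \sum_h e' h <= -1.
  apply: le_trans sum1; rewrite !split_sum (rest id) e'i e'j.
  by rewrite le_eqVlt; apply/orP; left; apply/eqP; field.
have sq' : \sum_h e' h ^+ 2 < N%:R / (2 * M ^+ 2).
  move: sq; rewrite !split_sum (rest (fun x => x ^+ 2)) e'i e'j /=.
  have -> : N.+1%:R / (2 * M ^+ 2) = N%:R / (2 * M ^+ 2) + M^-1 ^+ 2 / 2.
    by rewrite -natr1; field; rewrite gt_eqF.
  (* Averaging lowers the sum of squares by half the squared gap, and the gap is at least 1/d since
     e i >= 0 and e j <= -1/d. *)
  have : M^-1 ^+ 2 <= (e i - e j) ^+ 2.
    by move: ej Mi; generalize M^-1 => z ej z0; rewrite lerXn2r ?nnegrE; lra.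
  set T := \sum_(_ | _) _; set z := M^-1 ^+ 2; set Q := N%:R / _.
  by move: T z Q => T z Q; rewrite !expr2; lra.
(* The 5 absorbs the factor exp 5 lost by one spiral. Below, l >= 0 ensures that the side i is the
   longer one, as the spiral requires. *)
have [l0 Hl0] := IHN e' (c + 5) sq' sum'.
exists (Num.max 0 l0) => l; rewrite ge_max => /andP[l_ge0 /Hl0[F hF]].
have le_ij : l * e j + c <= l * e i + c.
  by rewrite lerD2r ler_wpM2l// (le_trans ej)// (le_trans _ ei)// oppr_le0 ltW.
have [G hG] := @squeezes_spiral R m.+1 (fun h => expR (l * e h + c)) i j
  (l * e i + c) (l * e j + c) ij le_ij erefl erefl.
exists (F \o G); apply: squeezes_comp hG _.
rewrite -[F]/(F \o id); apply: squeezes_comp hF; apply: squeezes_id => h.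
rewrite /e'; case: ifP => _; rewrite ler_expR; first by lra.
by rewrite addrA lerDl.
Qed.

(** * The tube *)

(** The integral of a nonnegative function is a supremum over simple functions below it, and this
    family grows with the function. The argument also covers iterated integrands whose measurability
    has not been established. *)
Lemma le_integral_nonneg d (T : measurableType d) (R : realType)
    (mu : {measure set T -> \bar R}) (f g : T -> \bar R) :
  (forall x, 0 <= f x)%E -> (forall x, f x <= g x)%E ->
  (\int[mu]_x f x <= \int[mu]_x g x)%E.
Proof.
move=> f0 fg; have g0 x : (0 <= g x)%E := le_trans (f0 x) (fg x).
rewrite !ge0_integralTE//; apply: ereal_sup_le => _ [h hf <-].
by exists h => // x; exact: le_trans (hf x) (fg x).
Qed.

Lemma le_integral_Rn (R : realType) n (f g : 'rV[R]_n -> \bar R) :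
  (forall x, 0 <= f x)%E -> (forall x, f x <= g x)%E ->
  (integral_Rn f <= integral_Rn g)%E.
Proof.
have ge0 p (h : 'rV[R]_p -> \bar R) :
    (forall x, 0 <= h x)%E -> (0 <= integral_Rn h)%E.
  elim: p h => [|p IHp] h h0 /=; first exact: h0.
  by apply: integral_ge0 => x _; exact: IHp.
elim: n f g => [|n IHn] f g f0 fg /=; first exact: fg.
apply: le_integral_nonneg => x; first exact: ge0.
exact: IHn.
Qed.

(** The preimage under g of a closed set A, within f(K), is the image of the compact set given by K
    and A, hence closed. *)
Lemma continuous_compact_left_inverse (T U : topologicalType) (K : set T)
    (f : T -> U) (g : U -> T) :
  hausdorff_space U -> compact K -> continuous f ->
  (forall x, K x -> g (f x) = x) -> {within f @` K, continuous g}.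
Proof.
move=> hU cK cf gf; apply/continuous_closedP => A clA.
apply/closed_subspaceP; exists (f @` (K `&` A)).
  apply: compact_closed => //; apply: continuous_compact.
    exact: continuous_subspaceT.
  exact: compact_closedI.
apply/seteqP; split=> y.
  by move=> [[x [Kx Ax] <-] _]; split; [change (A (g (f x))); rewrite gf|exists x].
move=> [Ay [x Kx fxy]]; split; last by exists x.
by exists x => //; split=> //; move: Ay; rewrite -fxy -{2}(gf x Kx).
Qed.

Lemma elementary_sum (R : realType) n (I : Type) (s : seq I)
    (f : I -> 'rV[R]_n -> R) :
  (forall i, elementary (f i)) -> elementary (fun x => \sum_(i <- s) f i x).
Proof.
move=> hf; elim: s => [|i s IHs].
  by under eq_fun do rewrite big_nil; exact: elementary_cst.
by under eq_fun do rewrite big_cons; exact: elementaryD.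
Qed.

Lemma elementary_continuous (R : realType) n (f : 'rV[R]_n -> R) :
  elementary f -> continuous f.
Proof. by move=> hf x; exact/differentiable_continuous/elementary_diff. Qed.

(* The domain R^2 x R^{m-1} with m = n + 3: the coordinates of the circle factor
   and the first coordinate of the ball factor. *)
Definition circle0 {n} : 'I_(2 + n.+2) := lshift n.+2 ord0.
Definition circle1 {n} : 'I_(2 + n.+2) := lshift n.+2 ord_max.
Definition height {n} : 'I_(2 + n.+2) := rshift 2 ord0.

(** * Geometry of the tube and of its stretched polar coordinates *)

Section Tube.
Context {R : realType} {n : nat}.
Implicit Types (x y v : 'rV[R]_(2 + n.+2)) (delta : R).

Lemma enorm_circle x :
  enorm (lsubmx x) = Num.sqrt (x 0 circle0 ^+ 2 + x 0 circle1 ^+ 2).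
Proof.
rewrite /enorm !big_ord_recl big_ord0 addr0 !mxE.
by rewrite (_ : lift ord0 ord0 = ord_max)//; exact: val_inj.
Qed.

Lemma tube_circle delta x : 0 < delta ->
  enorm (lsubmx x) = delta <-> x 0 circle0 ^+ 2 + x 0 circle1 ^+ 2 = delta ^+ 2.
Proof.
move=> d0; rewrite enorm_circle; split=> [<-|->].
  by rewrite sqr_sqrtr// addr_ge0 ?sqr_ge0.
by rewrite sqrtr_sqr gtr0_norm.
Qed.

Lemma tube_tangentE x v : @tube_tangent R n.+3 x v ->
  v 0 circle0 * x 0 circle0 + v 0 circle1 * x 0 circle1 = 0.
Proof.
move=> /matrixP/(_ 0 0); rewrite !mxE !big_ord_recl big_ord0 addr0 !mxE => <-.
by rewrite (_ : lift ord0 ord0 = ord_max)//; exact: val_inj.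
Qed.

Lemma eball_unit_sum p (y : 'rV[R]_p) : eball 1 y <-> \sum_i y 0 i ^+ 2 <= 1.
Proof.
rewrite /eball/= /enorm.
by rewrite -[X in _ <= X <-> _]sqrtr1 ler_sqrt// ler01.
Qed.

Lemma tube_coord delta x h : 0 < delta -> @solid_tube R n.+3 delta 1 x ->
  `|x 0 h| <= if h \in [:: circle0; circle1] then delta else 1.
Proof.
move=> d0 [/(tube_circle _ d0) xc /eball_unit_sum xb].
have sq_le (z c : R) : 0 <= c -> z ^+ 2 <= c ^+ 2 -> `|z| <= c.
  by move=> c0 zc; rewrite -(ger0_norm c0) -ler_sqr ?nnegrE// !real_normK ?num_real.
case: ifPn => [|hc].
  rewrite !inE => /orP[] /eqP ->; apply: sq_le; rewrite ?(ltW d0)// -xc.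
    by rewrite lerDl sqr_ge0.
  by rewrite lerDr sqr_ge0.
apply: sq_le => //; rewrite expr1n; apply: le_trans xb.
case: (splitP h) => [l hl|l hl].
  case/negP: hc; rewrite !inE -!val_eqE /= hl.
  by case: l {hl} => -[|[|]].
have -> : h = rshift 2 l by exact: val_inj.
rewrite (bigD1 l)//= mxE lerDl sumr_ge0// => i _; exact: sqr_ge0.
Qed.

Lemma solid_tube_compact delta : 0 < delta ->
  compact (@solid_tube R n.+3 delta 1).
Proof.
move=> d0; pose M := 1 + delta.
apply: (@subclosed_compact _ _
    [set x : 'rV[R]_(2 + n.+2) | forall h, x ord0 h \in `[- M, M]]).
- have -> : (@solid_tube R n.+3 delta 1) =
      (fun x => x 0 circle0 ^+ 2 + x 0 circle1 ^+ 2) @^-1` [set delta ^+ 2] `&`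
      (fun x => \sum_i x 0 (rshift 2 i) ^+ 2) @^-1` [set t | t <= 1].
    apply/seteqP; split=> x.
      move=> [/(tube_circle _ d0) xc /eball_unit_sum xb]; split=> //=.
      by apply: le_trans xb; apply: ler_sum => i _; rewrite mxE.
    move=> [/= /(tube_circle _ d0) xc xb]; split=> //; apply/eball_unit_sum.
    by apply: le_trans xb; apply: ler_sum => i _; rewrite mxE.
  have sq h : elementary (fun x : 'rV[R]_(2 + n.+2) => x 0 h ^+ 2).
    by under eq_fun do rewrite expr2; apply: elementaryM; exact: elementary_coord.
  apply: closedI; apply: preimage_closed.
  + by move=> x _; apply/elementary_continuous/elementaryD.
  + exact/accessible_closed_set1/hausdorff_accessible/Rhausdorff.
  + by move=> x _; apply/elementary_continuous/elementary_sum => i; exact: sq.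
  + exact: closed_le.
- by apply: (@rV_compact _ _ (fun=> `[- M, M]%classic)) => _; exact: segment_compact.
- move=> x /(tube_coord _ d0) xh h; rewrite in_itv/= -ler_norml.
  apply: le_trans (xh h) _; rewrite /M; case: ifP => _.
    by rewrite lerDr.
  by rewrite lerDl ltW.
Qed.

(* A surface inside the tube keeps |c|^2 = delta^2, so its partial derivatives
   are tangent to the circle factor. *)
Lemma surface_tangent delta k (U : set 'rV[R]_k)
    (phi : 'rV[R]_k -> 'rV[R]_(2 + n.+2)) (x v : 'rV[R]_k) :
  0 < delta -> open U -> differentiable phi x ->
  phi @` U `<=` @solid_tube R n.+3 delta 1 -> U x ->
  ('D_v phi x) 0 circle0 * phi x 0 circle0 +
  ('D_v phi x) 0 circle1 * phi x 0 circle1 = 0.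
Proof.
move=> d0 oU dphi sub Ux.
pose Q (y : 'rV[R]_(2 + n.+2)) : R := y 0 circle0 * y 0 circle0 + y 0 circle1 * y 0 circle1.
have eM i : elementary (fun y : 'rV[R]_(2 + n.+2) => y 0 i * y 0 i).
  by apply: elementaryM; exact: elementary_coord.
have eQ : elementary Q by exact: elementaryD.
have DQ : 'D_v (Q \o phi) x = 'D_('D_v phi x) Q (phi x).
  have dQ y : differentiable Q y by exact: elementary_diff.
  have dQphi : differentiable (Q \o phi) x by exact: differentiable_comp.
  rewrite (deriveE v dQphi) (deriveE v dphi) (deriveE _ (dQ (phi x))).
  by rewrite (diff_comp dphi (dQ (phi x))).
have : 'D_v (Q \o phi) x = 0.
  rewrite -(@derive_cst R 'rV[R]_k R (delta ^+ 2) x v); apply: near_eq_derive.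
  have : \near x, U x by exact: open_nbhs_nbhs.
  apply: filterS => y Uy.
  have /sub[/(tube_circle _ d0) <- _] : (phi @` U) (phi y) by exists y.
  by rewrite /Q/= -!expr2.
rewrite DQ derive_elementaryD// !derive_elementaryM; do ?exact: elementary_coord.
rewrite !derive_coord; lra.
Qed.

(* The circle times the height coordinate becomes an annulus in polar
   coordinates; the remaining coordinates are stretched. *)
Definition stretch (L : R) (x : 'rV[R]_(2 + n.+2)) : 'rV[R]_n.+3 :=
  \row_i if (i < 2)%N then L * ((2 + x 0 height) * x 0 (lift height i))
         else L * x 0 (lift height i).

Lemma stretch_elementary L : elementary_map (stretch L).
Proof.
move=> i; under eq_fun do rewrite mxE.
have ec (c : R) : elementary (fun _ : 'rV[R]_(2 + n.+2) => c) by exact: elementary_cst.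
have ex h : elementary (fun x : 'rV[R]_(2 + n.+2) => x 0 h) by exact: elementary_coord.
case: (i < 2)%N; apply: elementaryM => //; apply: elementaryM => //.
exact: elementaryD.
Qed.

Lemma derive_stretch L x v i : ('D_v (stretch L) x) 0 i =
  if (i < 2)%N then L * ((2 + x 0 height) * v 0 (lift height i) +
                         x 0 (lift height i) * v 0 height)
  else L * v 0 (lift height i).
Proof.
rewrite derive_elementary_map; last exact: stretch_elementary.
under eq_fun do rewrite mxE.
have ec (c : R) : elementary (fun _ : 'rV[R]_(2 + n.+2) => c) by exact: elementary_cst.
have ex h : elementary (fun x : 'rV[R]_(2 + n.+2) => x 0 h) by exact: elementary_coord.
case: (i < 2)%N.
  have e2 : elementary (fun x : 'rV[R]_(2 + n.+2) => 2 + x 0 height) by exact: elementaryD.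
  rewrite !derive_elementaryM//; last exact: elementaryM.
  by rewrite derive_elementaryD// !derive_coord !derive_cst; ring.
by rewrite derive_elementaryM// !derive_coord !derive_cst; ring.
Qed.

(** Skipping [height] puts the two circle coordinates first, which is why [stretch] separates the
    indices below 2. *)
Lemma lift_height0 : lift height ord0 = circle0 :> 'I_(2 + n.+2).
Proof. exact: val_inj. Qed.

Lemma lift_height1 : lift height (lift ord0 ord0) = circle1 :> 'I_(2 + n.+2).
Proof. exact: val_inj. Qed.

(** On tangent rows the map stretches the circle direction by L (2 + height), the height by L times
    the circle radius, and the rest by L. The circle part is split into L^2 plus the excess u, so
    that only rank one terms have other weights. *)
Lemma stretch_gram L x k (M : 'M[R]_(k, 2 + n.+2)) :
  (forall a, M a circle0 * x 0 circle0 + M a circle1 * x 0 circle1 = 0) ->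
  let N := M *m 'J (stretch L) x in
  let u := L ^+ 2 * ((2 + x 0 height) ^+ 2 - 1) in
  N *m N^T = L ^+ 2 *: (col' height M *m (col' height M)^T) +
    (L ^+ 2 * (x 0 circle0 ^+ 2 + x 0 circle1 ^+ 2)) *: (col height M *m (col height M)^T) +
    u *: (col circle0 M *m (col circle0 M)^T) +
    u *: (col circle1 M *m (col circle1 M)^T).
Proof.
move=> tM /=; set N := M *m _; set u := _ * (_ - 1).
have NE a i : N a i = if (i < 2)%N
    then L * ((2 + x 0 height) * M a (lift height i) +
              x 0 (lift height i) * M a height)
    else L * M a (lift height i).
  transitivity ((row a M *m 'J (stretch L) x) 0 i).
    by rewrite -row_mul [in RHS]mxE.
  rewrite -deriveEjacobian; last exact/elementary_map_diff/stretch_elementary.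
  by rewrite derive_stretch !mxE.
clearbody N; apply/matrixP => a b; rewrite !mxE !big_ord1 !mxE.
rewrite 2![in LHS]big_ord_recl 2![in RHS]big_ord_recl !mxE.
have -> : \sum_(i < n.+1) N a (lift ord0 (lift ord0 i)) * N^T (lift ord0 (lift ord0 i)) b
   = L ^+ 2 * \sum_(i < n.+1) col' height M a (lift ord0 (lift ord0 i)) *
     (col' height M)^T (lift ord0 (lift ord0 i)) b.
  rewrite mulr_sumr; apply: eq_bigr => i _.
  by rewrite ![_^T _ _]mxE !NE /= !mxE; ring.
set T := \sum_(i < n.+1) _.
rewrite !NE /= !lift_height0 !lift_height1.
have ta := tM a; have tb := tM b.
set X := 2 + _ in u *.
(* The cross terms between height and circle are grouped into the two tangency sums, which
   vanish. *)
transitivity (L ^+ 2 * (X ^+ 2 * (M a circle0 * M b circle0 + M a circle1 * M b circle1)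
  + X * M b height * (M a circle0 * x 0 circle0 + M a circle1 * x 0 circle1)
  + X * M a height * (M b circle0 * x 0 circle0 + M b circle1 * x 0 circle1)
  + (x 0 circle0 ^+ 2 + x 0 circle1 ^+ 2) * (M a height * M b height)) + L ^+ 2 * T).
  ring.
by rewrite ta tb /u; ring.
Qed.

Lemma gram_col'D k (M : 'M[R]_(k, 2 + n.+2)) h :
  col' h M *m (col' h M)^T + col h M *m (col h M)^T = M *m M^T.
Proof.
apply/matrixP => a b; rewrite !mxE big_ord1 !mxE [RHS](bigD1_ord h)//= addrC.
congr (_ + _); first by rewrite mxE.
by apply: eq_bigr => i _; rewrite !mxE.
Qed.

(** Since 2 + height >= 1, the excess u is nonnegative and both circle terms may be dropped. What
    remains has weight L^2 except (L delta)^2 on the height. *)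
Lemma stretch_det L delta x k (M : 'M[R]_(k.+1, 2 + n.+2)) :
  0 < delta -> delta <= 1 -> 0 < L -> @solid_tube R n.+3 delta 1 x ->
  (forall a, M a circle0 * x 0 circle0 + M a circle1 * x 0 circle1 = 0) ->
  L ^+ 2 ^+ k * (L * delta) ^+ 2 * \det (M *m M^T) <=
  \det ((M *m 'J (stretch L) x) *m (M *m 'J (stretch L) x)^T).
Proof.
move=> d0 d1 L0 tx tM; rewrite (stretch_gram _ tM).
have xh : -1 <= x 0 height.
  by have := tube_coord height d0 tx; rewrite /= ler_norml => /andP[].
have [/(tube_circle _ d0) -> _] := tx; rewrite -exprMn.
set S := col' _ M *m _; set u := L ^+ 2 * _.
have u0 : 0 <= u by rewrite mulr_ge0 ?sqr_ge0// expr2; nra.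
have psdS : psd S by exact: psd_gram.
have psd0 : psd (L ^+ 2 *: S + (L * delta) ^+ 2 *: (col height M *m (col height M)^T)).
  by apply: psdD; apply: psdZ; rewrite ?sqr_ge0//; exact: psd_gram.
apply: le_trans (det_psd_rank1_ge _ _ u0); last first.
  by apply: psdD => //; apply: psdZ => //; exact: psd_gram.
apply: le_trans (det_psd_rank1_ge _ psd0 u0).
rewrite -(gram_col'D _ height); apply: det_psd_rank1_scale => //.
  by rewrite exprn_gt0// mulr_gt0.
by rewrite exprMn ler_piMr ?sqr_ge0// expr_le1// ltW.
Qed.

(** The first two image coordinates have norm L delta (2 + height), which determines the height; 2 +
    height >= 1 can then be divided out. *)
Lemma stretch_inj L delta x y : 0 < delta -> 0 < L ->
  @solid_tube R n.+3 delta 1 x -> @solid_tube R n.+3 delta 1 y ->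
  stretch L x = stretch L y -> x = y.
Proof.
move=> d0 L0 tx ty xy.
have xyE i : stretch L x 0 i = stretch L y 0 i by rewrite xy.
have height_ge z : @solid_tube R n.+3 delta 1 z -> 1 <= 2 + z 0 height.
  move=> /(tube_coord height d0); rewrite /= ler_norml => /andP[zh _]; lra.
have hx := height_ge _ tx; have hy := height_ge _ ty.
have [/(tube_circle _ d0) cx _] := tx; have [/(tube_circle _ d0) cy _] := ty.
have h0 := xyE ord0; have h1 := xyE (lift ord0 ord0).
rewrite !mxE /= lift_height0 in h0; rewrite !mxE /= lift_height1 in h1.
have {}h0 := mulfI (lt0r_neq0 L0) h0; have {}h1 := mulfI (lt0r_neq0 L0) h1.
have hE : 2 + x 0 height = 2 + y 0 height.
  have E (z : 'rV[R]_(2 + n.+2)) : (2 + z 0 height) ^+ 2 * (z 0 circle0 ^+ 2 + z 0 circle1 ^+ 2) =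
      ((2 + z 0 height) * z 0 circle0) ^+ 2 + ((2 + z 0 height) * z 0 circle1) ^+ 2 by ring.
  have : (2 + x 0 height) ^+ 2 * delta ^+ 2 = (2 + y 0 height) ^+ 2 * delta ^+ 2.
    by rewrite -{1}cx -cy !E h0 h1.
  move=> /mulIf => /(_ (lt0r_neq0 (exprn_gt0 2 d0))) /eqP.
  by rewrite eqrXn2 ?(le_trans ler01 hx) ?(le_trans ler01 hy)// => /eqP.
apply/rowP => h; case: (unliftP height h) => [i ->|->]; last by lra.
have := xyE i; rewrite !mxE hE; case: ifP => _ /(mulfI (lt0r_neq0 L0))//.
by apply: mulfI; rewrite lt0r_neq0//; lra.
Qed.

Lemma stretch_box L delta x i : 0 < delta -> delta <= 1 -> 0 < L ->
  @solid_tube R n.+3 delta 1 x ->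
  `|stretch L x 0 i| <= if (i < 2)%N then 3 * (L * delta) else L.
Proof.
move=> d0 d1 L0 tx.
have hx : `|2 + x 0 height| <= 3.
  have := tube_coord height d0 tx; rewrite /= !ler_norml => /andP[? ?].
  by apply/andP; split; lra.
have hi := tube_coord (lift height i) d0 tx.
rewrite mxE; case: ifPn => i2; rewrite !normrM (gtr0_norm L0).
  rewrite mulrCA ler_pM ?mulr_ge0 ?(ltW L0)// ler_pM2l//; apply: le_trans hi _.
  suff -> : lift height i \in [:: circle0; circle1] by [].
  by move: i2; rewrite !inE -!val_eqE /= /bump; case: i => -[|[|]].
by rewrite -[leRHS]mulr1 ler_pM2l//; apply: le_trans hi _; case: ifP.
Qed.

End Tube.

(** * From boxes to the thick tube in a small ball *)

Lemma box_eball (R : realType) m (eps : R) (y : 'rV[R]_m.+1) : 0 < eps ->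
  box (fun=> eps / m.+1%:R) y -> eball eps y.
Proof.
move=> eps0 hy; have M1 : 1 <= m.+1%:R :> R by rewrite ler1n.
have M0 := lt_le_trans ltr01 M1.
have hy2 i : y 0 i ^+ 2 <= (eps / m.+1%:R) ^+ 2.
  by rewrite -ler_sqrt ?sqr_ge0// !sqrtr_sqr (ger0_norm (ltW (divr_gt0 _ _))).
rewrite /eball/= /enorm -(ger0_norm (ltW eps0)) -sqrtr_sqr ler_sqrt ?sqr_ge0//.
apply: (@le_trans _ _ (\sum_(i < m.+1) (eps / m.+1%:R) ^+ 2)).
  by apply: ler_sum => i _.
rewrite sumr_const card_ord -[leLHS]mulr_natr.
have -> : (eps / m.+1%:R) ^+ 2 * m.+1%:R = eps ^+ 2 / m.+1%:R.
  by field; rewrite gt_eqF.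
by rewrite ler_pdivrMr// ler_peMr ?sqr_ge0.
Qed.

(** The volume dimension is k + 1. With L = exp l and delta = L^(-k-1), the least stretch is L delta
    = L^(-k), compensated exactly by k factors L. *)
Lemma thick_tube_squeezes (R : realType) n k (l : R) (s t : 'I_n.+3 -> R)
    (F : 'rV[R]_n.+3 -> 'rV[R]_n.+3) : 0 <= l ->
  let delta := expR (- (l * k%:R) - l) in
  (forall i : 'I_n.+3,
     (if (i < 2)%N then 3 * expR (- (l * k%:R)) else expR l) <= s i) ->
  squeezes s t F ->
  @thick_tube R n.+3 k.+1 1 delta (F \o stretch (expR l)) /\
  (F \o stretch (expR l)) @` @solid_tube R n.+3 delta 1 `<=` box t.
Proof.
move=> l0 delta hs [eF iF bF vF]; set L := expR l.
have L0 : 0 < L := expR_gt0 _; have d0 : 0 < delta := expR_gt0 _.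
have L1 : 1 <= L by rewrite -expR0 ler_expR.
have lk : 0 <= l * k%:R by rewrite mulr_ge0.
have d1 : delta <= 1 by rewrite -expR0 ler_expR; lra.
have Ld : L * delta = expR (- (l * k%:R)).
  by rewrite -expRD; congr expR; ring.
have Lk : L ^+ 2 ^+ k * (L * delta) ^+ 2 = 1.
  by rewrite Ld exprAC -exprMn -expRM_natr -expRD subrr expR0 expr1n.
have boxG x : @solid_tube R n.+3 delta 1 x -> box s (stretch L x).
  move=> tx i; apply: le_trans (hs i); rewrite -Ld.
  exact: stretch_box.
have eG : elementary_map (stretch (n := n) L) by exact: stretch_elementary.
have eI : elementary_map (F \o stretch L) by exact: elementary_map_comp.
have injI x y : @solid_tube R n.+3 delta 1 x -> @solid_tube R n.+3 delta 1 y ->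
    F (stretch L x) = F (stretch L y) -> x = y.
  move=> tx ty /iF h; apply: (stretch_inj d0 L0 tx ty); apply: h; exact: boxG.
have JI x : 'J (F \o stretch L) x = 'J (stretch L) x *m 'J F (stretch L x).
  by apply: jacobian_comp; exact: elementary_map_diff.
split; last by move=> _ [x tx <-]; exact/bF/boxG.
split=> //; first split.
- by exists setT; split=> // [|s']; [exact: openT|exact: elementary_map_Cr].
- move=> x v tx /tube_tangentE tv.
  rewrite deriveEjacobian; last exact: elementary_map_diff.
  rewrite JI mulmxA => vI.
  (* Immersion is the one-dimensional case: a positive multiple of |v|^2 is at most the squared
     length of the image of v, which is 0. *)
  have /= := @stretch_det R n L delta x 0 v d0 d1 L0 tx.
  have tv' (a : 'I_1) : v a circle0 * x 0 circle0 + v a circle1 * x 0 circle1 = 0.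
    by rewrite ord1.
  move=> /(_ tv') /le_trans /(_ (vF _ (boxG _ tx) _ _)).
  rewrite vI mul0mx det0 expr0 mul1r pmulr_rle0 ?exprn_gt0 ?mulr_gt0//.
  rewrite det_mx11 mxE => le0; apply/rowP => i; rewrite mxE.
  have ge0 (j : 'I_(2 + n.+2)) : true -> 0 <= v 0 j * v^T j 0.
    by move=> _; rewrite mxE -expr2 sqr_ge0.
  have /eqP : \sum_j v 0 j * v^T j 0 = 0.
    by apply/eqP; rewrite eq_le le0 sumr_ge0.
  rewrite psumr_eq0// => /allP/(_ i (mem_index_enum _)).
  by rewrite mxE/= mulf_eq0 orbb => /eqP.
(* The inverse is obtained by choice, with value 0 off the image; compactness of the tube makes it
   continuous on the image. *)
- pose J y : 'rV[R]_(2 + n.+2) :=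
    xget 0 [set x | @solid_tube R n.+3 delta 1 x /\ F (stretch L x) = y].
  have JK x : @solid_tube R n.+3 delta 1 x -> J ((F \o stretch L) x) = x.
    by move=> tx; apply: xget_unique => // y [ty /injI]; exact.
  exists J; split=> //.
  apply: continuous_compact_left_inverse JK.
  + exact: norm_hausdorff.
  + exact: solid_tube_compact.
  + by move=> x; exact/differentiable_continuous/elementary_map_diff.
(* The volume densities are compared pointwise; off U both integrands are 0. *)
- move=> U phi [oU [dphi _] _ _ sub]; apply: le_integral_Rn => x.
    by rewrite /patch; case: ifP => // _; rewrite lee_fin sqrtr_ge0.
  rewrite /patch; case: ifPn => // /set_mem Ux; rewrite lee_fin.
  have tx : @solid_tube R n.+3 delta 1 (phi x) by apply: sub; exists x.
  rewrite ler_wsqrtr// jacobian_comp; [|exact: dphi|exact: elementary_map_diff].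
  rewrite JI mulmxA; apply: le_trans (vF _ (boxG _ tx) _ _).
  rewrite -[leLHS]mul1r -Lk; apply: stretch_det => // a.
  have := surface_tangent (delta_mx 0 a) d0 oU (dphi _ Ux) sub Ux.
  by rewrite (deriveEjacobian _ (dphi _ Ux)) -rowE !mxE.
Qed.

Unset Implicit Arguments.

Theorem mainTheorem7 (R : realType) (m k : nat) (hm : (3 <= m)%N)
    (hk : (m%:R + 1) / 2 <= k%:R :> R) (eps : R) (heps : 0 < eps) :
  exists (delta : R) (I : 'rV[R]_(2 + m.-1) -> 'rV[R]_m),
    thick_tube k 1 delta I /\ I @` solid_tube delta 1 `<=` eball eps.
Proof.
case: m hm hk => [|[|[|n]]]// _ hk.
case: k hk => [|k] hk.
  by have := ler0n R n.+3; move: hk; generalize (n.+3%:R : R) => z; lra.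
(* With m = n + 3 and k + 1 as the volume dimension, [hk] reads n + 4 <= 2 k + 2; the left side is
   the sum of the initial exponents, two equal to -k and n + 1 equal to 1. *)
have nk : n.+1%:R - 2 * k%:R <= - 1 :> R.
  by move: hk; rewrite -(addn3 n) -(addn1 n) -(addn1 k) !natrD; lra.
pose e (i : 'I_n.+3) : R := if (i < 2)%N then - k%:R else 1.
have sum_e : \sum_i e i <= -1.
  apply: le_trans nk; rewrite !big_ord_recl /e /= sumr_const card_ord; lra.
have eps0 : 0 < eps / n.+3%:R by rewrite divr_gt0.
(* The constant 2 absorbs the factor 3 of the annulus, as 3 <= exp 2. *)
have [l0 Hl0] := squeezes_exponents 2 eps0 sum_e.
have [F hF] := Hl0 (Num.max 0 l0) ltac:(by rewrite le_max lexx orbT).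
set l := Num.max 0 l0 in hF.
have l_ge0 : 0 <= l by rewrite le_max lexx.
have le_s (i : 'I_n.+3) : (if (i < 2)%N then 3 * expR (- (l * k%:R)) else expR l) <=
    expR (l * e i + 2).
  rewrite /e; case: ifP => _; last by rewrite ler_expR; lra.
  rewrite expRD mulrN mulrC ler_wpM2l ?expR_ge0//.
  by apply: le_trans (expR_ge1Dx 2); lra.
have [tube sub] := thick_tube_squeezes l_ge0 le_s hF.
exists (expR (- (l * k%:R) - l)), (F \o stretch (expR l)); split=> //.
by move=> y /sub; exact: box_eball.
Qed.
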